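(* (Type $q$-P$(E_2^{(1)};a)$.) Let $$L_1=\Bigl(g-\frac{\nu_5}{\kappa_2}\Bigr)\frac{\nu_1\nu_2\nu_3\nu_4}{f}+\frac{\nu_1z}{q}+\frac{\nu_1\nu_2\nu_3(\frac zq-\nu_4)}{f-\frac zq}(g-T_z^{-1})-\frac{\frac{\kappa_1}{\nu_8}z}{q(f-z)}\Bigl(T_z-\frac1g\Bigr).$$ Set $f=\nu_4$. Then the equation $L_1y(z)=0$ is written as $$\frac{\kappa_1z}{\nu_8}y(qz)+\Bigl(\nu_1z^2+dz+\frac{q\nu_1\nu_2\nu_3\nu_4\nu_5}{\kappa_2}\Bigr)y(z)+q\nu_1\nu_2\nu_3(z-\nu_4)y(z/q)=0,$$ $$d=\frac{\nu_1(q\nu_2\nu_3\nu_5+\kappa_2\nu_4)}{q\kappa_2}+\frac{\kappa_1}{q\nu_8}\frac1g .$$ By a gauge transformation, we obtain $$\frac{\kappa_1}{\nu_8}z(qz-\nu_4)y(qz)+\Bigl(\nu_1z^2+dz+\frac{q\nu_1\nu_2\nu_3\nu_4\nu_5}{\kappa_2}\Bigr)y(z)+q\nu_1\nu_2\nu_3\,y(z/q)=0.$$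
   Context: The parameters $\kappa_1,\kappa_2,\nu_1,\dots,\nu_8$ satisfy $\kappa_1^2\kappa_2^2=q\nu_1\nu_2\cdots\nu_8$. $T_z$ is the $q$-shift operator on the variable $z$: $T_zy(z)=y(qz)$, $T_z^{-1}y(z)=y(z/q)$. $L_1$ is an operator of the Kajiwara–Noumi–Yamada Lax pair for the $q$-Painlevé equation $q$-P$(E_2^{(1)};a)$, whose dependent variables $f,g$ are here treated as parameters. A gauge transformation means multiplying the unknown function by a suitable function; the new unknown function is again denoted by $y$.
   Formalization: The printed d is wrong by a factor: the formal statement uses d = -q times the printed expression, which L_1 y = 0 forces; the gauge transformation is claimed for |q| ≠ 1, since no meromorphic gauge function on the punctured plane exists for |q| = 1. *)

(* Defs.v *)
From HB Require Import structures.
From mathcomp Require Export all_boot all_order all_algebra.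
From mathcomp Require Export complex.
From mathcomp Require Export all_classical all_reals all_analysis.
Export Order.TTheory GRing.Theory Num.Theory.
Export numFieldNormedType.Exports.

Set Implicit Arguments.
Unset Strict Implicit.
Unset Printing Implicit Defensive.

Local Open Scope ring_scope.
Local Open Scope complex_scope.

Definition qshift (R : realType) (q : R[i]) (y : R[i] -> R[i]) : R[i] -> R[i] :=
  fun z => y (q * z).

Definition qshiftV (R : realType) (q : R[i]) (y : R[i] -> R[i]) : R[i] -> R[i] :=
  fun z => y (z / q).

(* [L1] has poles at [z = f] and [z = q * f]; as division is total, its value
   there is meaningless. *)
Definition L1 (R : realType) (q kappa1 kappa2 nu1 nu2 nu3 nu4 nu5 nu8 f g : R[i])
    (y : R[i] -> R[i]) : R[i] -> R[i] :=
  fun z =>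
    (g - nu5 / kappa2) * (nu1 * nu2 * nu3 * nu4 / f) * y z
    + nu1 * z / q * y z
    + nu1 * nu2 * nu3 * (z / q - nu4) / (f - z / q)
        * (g * y z - qshiftV q y z)
    - kappa1 / nu8 * z / (q * (f - z))
        * (qshift q y z - g^-1 * y z).

(* A function holomorphic on the punctured plane and not identically zero
   there. By the identity theorem its zeros are isolated, and the nonzero
   meromorphic functions on the punctured plane are exactly the quotients of two
   such functions. *)
Definition nonzero_holomorphic (R : realType) (h : R[i] -> R[i]) : Prop :=
  (forall z : R[i], z != 0 -> derivable (h : R[i]^o -> R[i]^o) z 1) /\
  (exists2 z : R[i], z != 0 & h z != 0).

(* Main.v *)
Require Import Defs.
From mathcomp Require Import all_boot all_order all_algebra complex.
From mathcomp Require Import all_classical all_reals all_analysis.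
From mathcomp Require Import ring lra.

Local Open Scope ring_scope.
Local Open Scope complex_scope.

(** For [f = nu4] the factor [(z / q - nu4) / (f - z / q)] is [- 1], and
    multiplying [L1 y] by [q * (z - nu4)] gives the first form. The gauge
    transformation needs a function meromorphic on the punctured plane with
    [u (q * z) = (q * z - nu4) * u z]. If [`|q| < 1], let [E] be the entire
    function [E x = (x; q)_oo], which satisfies [E x = (1 - x) * E (q * x)];
    then [u z = z * E (nu4 / z) / (E (- z) * E (- q / z))] works. If
    [`|q| > 1] and [v] is the solution for [q^-1], take [u z = 1 / v (q * z)]. *)

(** * Complex series dominated by a geometric series of ratio one half *)

Section GeometricSeries.
Local Open Scope classical_set_scope.
Variable R : realType.
Implicit Types (u v : nat -> R[i]) (M : R[i]) (w : nat -> R).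

Lemma normc_le_ReIm (x : R[i]) : `|x| <= (`|Re x| + `|Im x|)%:C.
Proof.
have normR (r : R) : `|r%:C| = `|r|%:C.
  by rewrite normc_def /= expr0n /= addr0 sqrtr_sqr.
rewrite {1}(complexE x) rmorphD /= -!normR (le_trans (ler_normD _ _))//.
rewrite normrM lerD2l.
suff -> : `|'i%C : R[i]| = 1 by rewrite mul1r.
by rewrite normc_def /= expr0n expr1n add0r sqrtr1.
Qed.

Lemma normc_ge_Im (x : R[i]) : `|Im x|%:C <= `|x|.
Proof.
rewrite normc_def lecR -sqrtr_sqr ler_sqrt ?addr_ge0 ?sqr_ge0//.
by rewrite lerDr sqr_ge0.
Qed.

(** Comparison with the geometric series of ratio [1 / 2], whose sum is [2 * m], gives absolute
    convergence and the bound together. *)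
Lemma geometric_dominated_series (m : R) w :
  (forall n, `|w n| <= m / 2 ^+ n) ->
  cvgn (series w) /\ `|limn (series w)| <= 2 * m.
Proof.
move=> wm.
have half1 : `|2^-1 : R| < 1 by rewrite ger0_norm; lra.
have gE n : m / 2 ^+ n = geometric m 2^-1 n by rewrite /geometric /= exprVn.
have cvgg : cvgn (series (geometric m 2^-1)).
  exact: is_cvg_geometric_series.
have cvgn_w : cvgn [normed series w].
  apply: (series_le_cvg _ _ _ cvgg) => n; first exact: normr_ge0.
    by rewrite -gE (le_trans _ (wm n)).
  by rewrite -gE wm.
split; first exact: normed_cvg.
apply: le_trans (lim_series_norm cvgn_w) _.
suff -> : 2 * m = limn (series (geometric m 2^-1)).
  by apply: lim_series_le => // n; rewrite -gE wm.
rewrite (cvg_lim _ (cvg_geometric_series (a := m) half1))//.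
by field.
Qed.

Definition geometric_dominated M u := forall n, `|u n| <= M / 2 ^+ n.

(** The order on [R[i]] makes [0 <= M] say that [M] is real, so the bound descends to real and
    imaginary parts. *)
Lemma geometric_dominated_parts M u : geometric_dominated M u ->
  exists2 m : R, M = m%:C &
  forall n, `|Re (u n)| <= m / 2 ^+ n /\ `|Im (u n)| <= m / 2 ^+ n.
Proof.
move=> uM; have := le_trans (normr_ge0 _) (uM 0%N).
rewrite expr0 divr1 => M0; exists (Re M) => [|n].
  by rewrite RRe_real// ger0_real.
have ME : M / 2 ^+ n = (Re M / 2 ^+ n)%:C.
  by rewrite -[M in LHS]RRe_real ?ger0_real// rmorphM fmorphV rmorphXn /= rmorph_nat.
by split; rewrite -lecR -ME (le_trans _ (uM n))// ?normc_ge_Re ?normc_ge_Im.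
Qed.

(* [R[i]] has no completeness instance in the library, hence the detour through
   real and imaginary parts. *)
Definition csum u : R[i] :=
  limn (series (fun n => Re (u n))) +i* limn (series (fun n => Im (u n))).

(** The real and the imaginary part contribute [2 * M] each. *)
Lemma norm_csum_le M u : geometric_dominated M u -> `|csum u| <= 4 * M.
Proof.
move=> /geometric_dominated_parts[m ->] um.
have [_ hr] := geometric_dominated_series _ _ (fun n => (um n).1).
have [_ hi] := geometric_dominated_series _ _ (fun n => (um n).2).
apply: le_trans (normc_le_ReIm _) _.
have -> : 4 * m%:C = (4 * m)%:C :> R[i] by rewrite rmorphM rmorph_nat.
by rewrite lecR /=; lra.
Qed.

Lemma csumD M N u v : geometric_dominated M u -> geometric_dominated N v ->
  csum (fun n => u n + v n) = csum u + csum v.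
Proof.
move=> /geometric_dominated_parts[m _ um] /geometric_dominated_parts[n _ vn].
have [ur _] := geometric_dominated_series _ _ (fun k => (um k).1).
have [ui _] := geometric_dominated_series _ _ (fun k => (um k).2).
have [vr _] := geometric_dominated_series _ _ (fun k => (vn k).1).
have [vi _] := geometric_dominated_series _ _ (fun k => (vn k).2).
apply/eqP; rewrite eq_complex /= -!lim_seriesD//.
by apply/andP; split; apply/eqP; congr (limn (series _)); apply/funext => k;
  rewrite !fctE; case: (u k) (v k) => [? ?] [? ?].
Qed.

Lemma csumZ M u a : geometric_dominated M u ->
  csum (fun n => a * u n) = a * csum u.
Proof.
move=> /geometric_dominated_parts[m _ um].
have [ur _] := geometric_dominated_series _ _ (fun k => (um k).1).
have [ui _] := geometric_dominated_series _ _ (fun k => (um k).2).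
case: a => a b; apply/eqP; rewrite eq_complex /=.
have Z (k : R) w : cvgn (series w) -> k * limn (series w) = limn (series (k *: w)).
  by move=> cw; rewrite lim_seriesZ.
rewrite !Z// -lim_seriesD -?lim_seriesB//; do ?exact: is_cvg_seriesZ.
by apply/andP; split; apply/eqP; congr (limn (series _)); apply/funext => k;
  rewrite !fctE; case: (u k).
Qed.

Lemma geometric_dominatedZ M u a : geometric_dominated M u ->
  geometric_dominated (`|a| * M) (fun n => a * u n).
Proof. by move=> hu n; rewrite normrM -mulrA ler_wpM2l. Qed.

Lemma geometric_dominatedB M N u v :
  geometric_dominated M u -> geometric_dominated N v ->
  geometric_dominated (M + N) (fun n => u n - v n).
Proof.
by move=> hu hv n; rewrite mulrDl (le_trans (ler_normB _ _))// lerD.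
Qed.

Lemma csumB M N u v : geometric_dominated M u -> geometric_dominated N v ->
  csum (fun n => u n - v n) = csum u - csum v.
Proof.
move=> hu hv; rewrite -(mulN1r (csum v)) -(csumZ _ _ _ hv).
rewrite -(csumD _ _ _ _ hu (geometric_dominatedZ _ _ (-1) hv)).
by congr csum; apply/funext => n; rewrite mulN1r.
Qed.

Lemma csum_recl M u : geometric_dominated M u ->
  csum u = u 0%N + csum (fun n => u n.+1).
Proof.
move=> /geometric_dominated_parts[m _ um].
have [ur _] := geometric_dominated_series _ _ (fun k => (um k).1).
have [ui _] := geometric_dominated_series _ _ (fun k => (um k).2).
have shift w : cvgn (series w) ->
    limn (series w) = w 0%N + limn (series (fun n => w n.+1)).
  move=> cw; have E n : series w n.+1 = w 0%N + series (fun k => w k.+1) n.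
    by rewrite !seriesEnat /= big_nat_recl.
  have cS : series w n.+1 @[n --> \oo] --> limn (series w).
    by move: cw; rewrite -(cvg_shiftS (series w)).
  apply/eqP; rewrite addrC -subr_eq; apply/eqP/esym/cvg_lim => //.
  under eq_cvg do rewrite -[series _ _](addKr (w 0%N)) -E addrC.
  by apply: cvgB => //; exact: cvg_cst.
apply/eqP; rewrite eq_complex /csum (shift _ ur) (shift _ ui).
by case: (u 0%N) => /= ? ?; rewrite !eqxx.
Qed.

End GeometricSeries.

(** Second-order remainder of a power, for termwise differentiation. By induction: the remainder [D]
    at [n] becomes [(x + h) * D + h ^+ 2 * (n%:R * x ^+ n.-1)] at [n.+1], and each summand takes
    half of the new bound, the second by [n <= 2 ^ n] and [1 <= r]. *)
Lemma exprD_increment_le (K : numFieldType) (x h r : K) (n : nat) : 1 <= r -> `|x| <= r -> `|x + h| <= r ->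
  `|(x + h) ^+ n - x ^+ n - h * (n%:R * x ^+ n.-1)| <= `|h| ^+ 2 * (2 * r) ^+ n.
Proof.
move=> r1 xr xhr; have r0 : 0 <= r by exact: le_trans r1.
elim: n => [|n IH].
  by rewrite !expr0 mul0r mulr0 subrr subr0 normr0 mulr1 exprn_ge0.
set D := _ - _ - _ in IH.
have -> : (x + h) ^+ n.+1 - x ^+ n.+1 - h * (n.+1%:R * x ^+ n.+1.-1)
    = (x + h) * D + h ^+ 2 * (n%:R * x ^+ n.-1).
  rewrite /D; case: n {IH D} => [|n] /=; first by rewrite !expr0 expr1; ring.
  by rewrite !exprS -!natr1; ring.
apply: le_trans (ler_normD _ _) _.
have -> : `|h| ^+ 2 * (2 * r) ^+ n.+1
    = r * (`|h| ^+ 2 * (2 * r) ^+ n) + `|h| ^+ 2 * (r * (2 * r) ^+ n).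
  by rewrite [(2 * r) ^+ n.+1]exprS; ring.
apply: lerD; rewrite normrM; first exact: ler_pM.
rewrite normrX ler_wpM2l ?exprn_ge0// normrM normr_nat normrX.
rewrite exprMn mulrCA ler_pM ?exprn_ge0//.
  by rewrite -natrX ler_nat ltnW// ltn_expl.
apply: (@le_trans _ _ (r ^+ n.-1)); first by rewrite lerXn2r ?nnegrE.
by rewrite -exprS ler_weXn2l// (leq_trans (leq_pred n)).
Qed.

(** * Entire power series: differentiability and behaviour at the origin *)

Section EntireSeries.
Local Open Scope classical_set_scope.
Variable R : realType.
Implicit Types (c : nat -> R[i]) (x h : R[i]).

(** Boundedness for every [s] amounts to an infinite radius of convergence. *)
Definition entire_coef c :=
  forall s : R[i], 0 <= s -> exists M, forall n, `|c n| * s ^+ n <= M.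

Definition entire_series c x := csum R (fun n => c n * x ^+ n).

(** Boundedness at radius [2 * r] leaves a spare factor [2 ^+ n]. As [M] does not depend on [v], one
    constant serves powers, derivatives and increments alike. *)
Lemma entire_coef_dominated c (r : R[i]) : entire_coef c -> 0 <= r ->
  exists2 M, 0 <= M & forall K (v : nat -> R[i]), 0 <= K ->
    (forall n, `|v n| <= K * r ^+ n) ->
    geometric_dominated R (K * M) (fun n => c n * v n).
Proof.
move=> hc r0; have [|M hM] := hc (2 * r); first by rewrite mulr_ge0.
exists M => [|K v K0 hv n].
  by apply: le_trans (hM 0%N); rewrite expr0 mulr1.
rewrite normrM ler_pdivlMr ?exprn_gt0//.
apply: (@le_trans _ _ (K * (`|c n| * (2 * r) ^+ n))); last by rewrite ler_wpM2l.
have -> : K * (`|c n| * (2 * r) ^+ n) = `|c n| * (K * r ^+ n) * 2 ^+ n.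
  by rewrite exprMn; ring.
by rewrite ler_wpM2r ?exprn_ge0// ler_wpM2l.
Qed.

(** The termwise derivative [D] is the limit, because summing the remainders of the powers leaves an
    error of at most [4 * M] times the square of the norm of [h]. *)
Lemma entire_series_derivable c x : entire_coef c ->
  derivable (entire_series c : R[i]^o -> R[i]^o) x 1.
Proof.
move=> hc; set r : R[i] := `|x| + 1.
have r1 : 1 <= r by rewrite lerDr.
have r0 : 0 <= r by exact: le_trans r1.
have xr : `|x| <= r by rewrite lerDl.
(* The disk of radius [r] contains [x + h] for all [h] of norm at most 1; the doubled radius matches
   the bound [(2 * r) ^+ n] of [exprD_increment_le]. *)
have [|M M0 hM] := entire_coef_dominated c (2 * r) hc; first by rewrite mulr_ge0.
pose D := csum R (fun n => c n * (n%:R * x ^+ n.-1)).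
have rr n : r ^+ n <= (2 * r) ^+ n.
  by rewrite lerXn2r ?nnegrE ?mulr_ge0// ler_peMl// ler1n.
have domX y : `|y| <= r -> geometric_dominated R (1 * M) (fun n => c n * y ^+ n).
  move=> yr; apply: hM => // n; rewrite mul1r normrX (le_trans _ (rr n))//.
  by rewrite lerXn2r ?nnegrE.
have domD : geometric_dominated R (1 * M) (fun n => c n * (n%:R * x ^+ n.-1)).
  apply: hM => // n; rewrite mul1r normrM normr_nat normrX exprMn.
  apply: ler_pM; rewrite ?exprn_ge0//.
    by rewrite -natrX ler_nat ltnW// ltn_expl.
  apply: (@le_trans _ _ (r ^+ n.-1)); first by rewrite lerXn2r ?nnegrE.
  by rewrite ler_weXn2l// leq_pred.
have quad h : `|h| <= 1 ->
    `|entire_series c (x + h) - entire_series c x - h * D| <= `|h| ^+ 2 * (4 * M).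
  move=> h1; have xhr : `|x + h| <= r by rewrite (le_trans (ler_normD _ _))// lerD2l.
  rewrite /entire_series /D -(csumZ _ _ _ _ domD).
  rewrite -(csumB _ _ _ _ _ (domX _ xhr) (domX _ xr)).
  rewrite -(csumB _ _ _ _ _ (geometric_dominatedB _ _ _ _ _ (domX _ xhr) (domX _ xr))
    (geometric_dominatedZ _ _ _ _ domD)).
  rewrite mulrCA; apply: norm_csum_le => n.
  have := hM (`|h| ^+ 2) (fun n => (x + h) ^+ n - x ^+ n - h * (n%:R * x ^+ n.-1)).
  rewrite exprn_ge0// => /(_ erefl) hM'.
  have := hM' (fun n => exprD_increment_le _ x h r n r1 xr xhr) n.
  by congr (`| _ | <= _); ring.
apply/cvg_ex; exists D.
apply/(@cvgrPdist_le _ R[i]^o) => e e0.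
have K0 : 0 < 4 * M + 1 by rewrite ltr_wpDl// mulr_ge0.
near=> h.
have h0 : h != 0 by near: h; exact: nbhs_dnbhs_neq.
have h1 : `|h| <= 1.
  by apply: ltW; near: h; exact: dnbhs0_lt.
have he : `|h| <= e / (4 * M + 1).
  by apply: ltW; near: h; apply: dnbhs0_lt; rewrite divr_gt0.
have hn : 0 < `|h| by rewrite normr_gt0.
rewrite distrC -(ler_pM2l hn) -normrM.
rewrite [X in `|X|](_ : _ = entire_series c (x + h) - entire_series c x - h * D); last first.
  rewrite /= mulrBr; congr (_ - _).
  by rewrite /GRing.scale /= mulr1 mulrA divff// mul1r [h + x]addrC.
apply: le_trans (quad h h1) _.
rewrite expr2 -mulrA ler_wpM2l//.
apply: (@le_trans _ _ (`|h| * (4 * M + 1))); first by rewrite ler_wpM2l// lerDl.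
by rewrite -ler_pdivlMr.
Unshelve. all: by end_near.
Qed.

Lemma entire_series_sub0_le c : entire_coef c ->
  exists2 K : R[i], 0 < K & forall h, `|h| <= 1 ->
    `|entire_series c h - c 0%N| <= K * `|h|.
Proof.
move=> hc; have [M M0 hM] := entire_coef_dominated c 1 hc ler01.
exists (4 * M + 1) => [|h h1]; first by rewrite ltr_wpDl// mulr_ge0.
have dom : geometric_dominated R (1 * M) (fun n => c n * h ^+ n).
  by apply: hM => // n; rewrite expr1n mulr1 normrX exprn_ile1.
(* With the constant term replaced by 0, every term has a factor [h], which yields a bound linear in
   the norm of [h]. *)
have domS : geometric_dominated R (`|h| * M) (fun n => c n * (if n is 0%N then 0 else h ^+ n)).
  apply: hM => // -[|n]; rewrite expr1n mulr1 ?normr0//.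
  by rewrite normrX exprS ler_piMr// exprn_ile1.
have E : csum R (fun n => c n * (if n is 0%N then 0 else h ^+ n))
    = entire_series c h - c 0%N.
  rewrite /entire_series (csum_recl _ _ _ dom) (csum_recl _ _ _ domS).
  by rewrite mulr0 expr0 mulr1 add0r [c 0%N + _]addrC addrK.
rewrite -E (le_trans (norm_csum_le _ _ _ domS))//.
by rewrite mulrCA mulrC ler_wpM2r// lerDl.
Qed.

End EntireSeries.

(** * The entire function [(x; q)_oo] for [q] in the open unit disk *)

Section QPochhammer.
Local Open Scope classical_set_scope.
Variables (R : realType) (q : R[i]).
Hypothesis q1 : `|q| < 1.

Lemma exists_exprn_le (e : R[i]) : 0 < e -> exists N, `|q| ^+ N <= e.
Proof.
move=> e0; have eR : (Re e)%:C = e by rewrite RRe_real// gtr0_real.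
have qR : (Re `|q|)%:C = `|q| by rewrite RRe_real// ger0_real.
have eR0 : 0 < Re e by rewrite -ltcR eR.
have t1 : Re `|q| < 1 by rewrite -ltcR qR.
have t0 : 0 <= Re `|q| by rewrite -ler0c qR.
have /cvgrPdist_le/(_ _ eR0)[N _ HN] := @cvg_expr R (Re `|q|) ltac:(by rewrite ger0_norm).
exists N; rewrite -qR -eR -rmorphXn /= lecR.
by have := HN N (leqnn N); rewrite /= sub0r normrN ger0_norm// exprn_ge0.
Qed.

(* The Taylor coefficients at [0] of the infinite product of the
   [1 - q ^+ k * x], as forced by [E x = (1 - x) * E (q * x)] and [E 0 = 1]. *)
Fixpoint qpoch_coef n : R[i] :=
  if n is m.+1 then - q ^+ m / (1 - q ^+ m.+1) * qpoch_coef m else 1.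

Definition qpoch := entire_series R qpoch_coef.

Lemma subr_expr_neq0 n : 1 - q ^+ n.+1 != 0.
Proof.
rewrite subr_eq0; apply/eqP => /(congr1 Num.Def.normr) /esym.
rewrite normr1 normrX => E; have : `|q| ^+ n.+1 < 1 by rewrite exprn_ilt1.
by rewrite E ltxx.
Qed.

(** The ratio of consecutive terms is at most [|q| ^+ n * (s / (1 - |q|))], which tends to 0, so the
    terms eventually decrease. *)
Lemma qpoch_coef_entire : entire_coef R qpoch_coef.
Proof.
move=> s s0; pose t n := `|qpoch_coef n| * s ^+ n.
have t0 n : 0 <= t n by rewrite mulr_ge0// exprn_ge0.
have d0 : 0 < 1 - `|q| by rewrite subr_gt0.
have step n : t n.+1 <= `|q| ^+ n * (s / (1 - `|q|)) * t n.
  rewrite /t /= normrM normrM normrN normfV normrX [s ^+ n.+1]exprS.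
  rewrite [leRHS](_ : _ = `|q| ^+ n / (1 - `|q|) * `|qpoch_coef n| * (s * s ^+ n)); last first.
    by move: (s ^+ n) (`|q| ^+ n) (1 - `|q|)^-1 => X Y Z; ring.
  rewrite ler_wpM2r ?mulr_ge0 ?exprn_ge0// ler_wpM2r// ler_wpM2l ?exprn_ge0//.
  rewrite lef_pV2 ?posrE ?normr_gt0 ?subr_expr_neq0//.
  apply: le_trans (lerB_dist _ _); rewrite normr1 lerD2l lerN2 normrX.
  by rewrite exprS ler_piMr// exprn_ile1// ltW.
(* From this [N] on the ratio is at most 1; the added 1 keeps the inverted number positive when
   [s = 0]. *)
have [|N HN] := exists_exprn_le (s / (1 - `|q|) + 1)^-1.
  by rewrite invr_gt0 ltr_wpDl// divr_ge0// ltW.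
have decr n : (N <= n)%N -> t n.+1 <= t n.
  move=> Nn; apply: le_trans (step n) _; rewrite ler_piMl//.
  have k0 : 0 <= s / (1 - `|q|) by rewrite divr_ge0// ltW.
  apply: (@le_trans _ _ ((s / (1 - `|q|) + 1)^-1 * (s / (1 - `|q|)))).
    rewrite ler_wpM2r//; apply: le_trans HN.
    by rewrite ler_wiXn2l// ltW.
  by rewrite mulrC ler_pdivrMr ?ltr_wpDl// mul1r lerDl.
exists (\sum_(i < N.+1) t i); elim=> [|n IH].
  by rewrite big_ord_recl lerDl sumr_ge0.
have [nN|nN] := ltnP n N; last exact: le_trans (decr _ nN) IH.
by rewrite (bigD1 (Ordinal (nN : (n.+1 < N.+1)%N)))//= lerDl sumr_ge0.
Qed.

(** In the form [E x - E (q * x) = - x * E (q * x)] the constant terms cancel, and comparing the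
    other coefficients gives the recursion of [qpoch_coef]. *)
Lemma qpochE x : qpoch x = (1 - x) * qpoch (q * x).
Proof.
have dom y : exists M, geometric_dominated R M (fun n => qpoch_coef n * y ^+ n).
  have [M _ hM] := entire_coef_dominated _ _ _ qpoch_coef_entire (normr_ge0 y).
  by exists (1 * M); apply: hM => // n; rewrite mul1r normrX.
have [M domx] := dom x; have [N domqx] := dom (q * x).
rewrite mulrBl mul1r; apply/eqP; rewrite -subr_eq0 opprB addrA addrAC.
rewrite addr_eq0; apply/eqP.
rewrite /qpoch /entire_series -(csumB _ _ _ _ _ domx domqx).
rewrite (csum_recl _ _ _ (geometric_dominatedB _ _ _ _ _ domx domqx)).
rewrite !expr0 subrr add0r -mulNr -(csumZ _ _ _ _ domqx).
congr (csum R); apply/funext => n /=.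
have := subr_expr_neq0 n.
rewrite exprMn [(q * x) ^+ n]exprMn !exprS.
move: (qpoch_coef n) (x ^+ n) (q ^+ n) => c X Q h.
by field.
Qed.

(** A zero at [x] would propagate through [qpochE] to all [q ^+ n * x], which tend to 0, where the
    value is near 1. *)
Lemma qpoch_neq0 x : (forall n, q ^+ n * x != 1) -> qpoch x != 0.
Proof.
move=> hx; apply/eqP => E0.
have E n : qpoch (q ^+ n * x) = 0.
  elim: n => [|n IH]; first by rewrite expr0 mul1r.
  have /eqP := IH; rewrite qpochE mulf_eq0 subr_eq0 eq_sym (negPf (hx n)) /=.
  by rewrite mulrA -exprS => /eqP.
have [K K0 hK] := entire_series_sub0_le _ _ qpoch_coef_entire.
(* This brings [q ^+ N * x] within [1 / (K + 2)] of 0, so the zero there would give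
   [1 <= K / (K + 2)]. *)
have [|N HN] := exists_exprn_le ((`|x| + 1)^-1 * ((K + 1 + 1)^-1)).
  by rewrite mulr_gt0// invr_gt0 ?ltr_wpDl// ?addr_ge0// ltW.
have xN : `|q ^+ N * x| <= (K + 1 + 1)^-1.
  rewrite normrM normrX; apply: le_trans (ler_wpM2r (normr_ge0 x) HN) _.
  rewrite mulrAC ler_piMl ?invr_ge0 ?addr_ge0// ?(ltW K0)//.
  by rewrite mulrC ler_pdivrMr ?ltr_wpDl// mul1r lerDl.
have K2 : 0 < K + 1 + 1 by rewrite ltr_wpDl// addr_ge0// ltW.
have xN1 : `|q ^+ N * x| <= 1.
  by apply: le_trans xN _; rewrite invf_le1// lerDr addr_ge0// ltW.
have := hK _ xN1; rewrite -/(qpoch _) E /= sub0r normrN normr1 => h.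
have : 1 <= K / (K + 1 + 1).
  by apply: le_trans h _; rewrite ler_wpM2l// ltW.
rewrite ler_pdivlMr// mul1r -addrA gerDl => /le_gtF.
by rewrite ltr_wpDl.
Qed.

Lemma qpoch_derivable x : derivable (qpoch : R[i]^o -> R[i]^o) x 1.
Proof. exact: entire_series_derivable qpoch_coef_entire. Qed.

End QPochhammer.

(** * Solving [u (q * z) = (q * z - nu) * u z] by a quotient [a / b] of holomorphic functions *)

Section GaugeFactor.
Variable R : realType.
Implicit Types (q nu x z : R[i]).

Lemma derivable_compc (f g : R[i] -> R[i]) z :
  derivable (f : R[i]^o -> R[i]^o) z 1 ->
  derivable (g : R[i]^o -> R[i]^o) (f z) 1 ->
  derivable ((fun x => g (f x)) : R[i]^o -> R[i]^o) z 1.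
Proof.
move=> /(@derivable1_diffP R[i] R[i]^o) df /(@derivable1_diffP R[i] R[i]^o) dg.
apply/(@derivable1_diffP R[i] R[i]^o).
exact: (@differentiable_comp R[i] R[i]^o R[i]^o R[i]^o f g z df dg).
Qed.

Lemma derivable_mulc (a z : R[i]) :
  derivable ((fun x => a * x) : R[i]^o -> R[i]^o) z 1.
Proof.
apply: (@derivableM R[i] R[i]^o (cst a) id z 1); first exact: derivable_cst.
exact: derivable_id.
Qed.

Lemma derivable_divc (a z : R[i]) : z != 0 ->
  derivable ((fun x => a / x) : R[i]^o -> R[i]^o) z 1.
Proof.
move=> z0; apply: derivable_compc (derivable_mulc _ _).
by apply: (@derivableV R[i] R[i]^o id z 1 z0); exact: derivable_id.
Qed.

Lemma nonzero_holomorphic_scale q h : q != 0 -> nonzero_holomorphic h ->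
  nonzero_holomorphic (fun z : R[i] => h (q * z)).
Proof.
move=> q0 [dh [z z0 hz]]; split=> [x x0|].
  by apply: derivable_compc (derivable_mulc _ _) (dh _ _); rewrite mulf_neq0.
by exists (z / q); rewrite ?mulf_neq0 ?invr_neq0// mulrCA divff// mulr1.
Qed.

Lemma exprM_neq1 q x : `|q| < 1 -> `|x| <= 1 -> x != 1 ->
  forall n, q ^+ n * x != 1.
Proof.
move=> q1 x1 xn1 [|n]; first by rewrite mul1r.
apply: contraTneq isT => /(congr1 Num.Def.normr); rewrite normr1 normrM => E.
have : `|q ^+ n.+1| < 1 by rewrite normrX exprn_ilt1.
rewrite -E; suff /le_gtF -> : `|q ^+ n.+1| * `|x| <= `|q ^+ n.+1| by [].
by rewrite ler_piMr.
Qed.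

(* With [E = qpoch q], [z -> E (nu / z)] is multiplied by [1 - nu / (q * z)]
   under [z -> q * z], while the theta function [E (- z) * E (- q / z)] is
   divided by [z]. *)
Lemma gauge_factor_lt1 q nu : q != 0 -> `|q| < 1 -> nu != 0 ->
  exists a b : R[i] -> R[i],
    [/\ nonzero_holomorphic a, nonzero_holomorphic b &
     forall z, z != 0 -> a (q * z) * b z = (q * z - nu) * (a z * b (q * z))].
Proof.
move=> q0 q1 nu0; pose E := qpoch R q.
have En0 x : `|x| <= 1 -> x != 1 -> E x != 0.
  by move=> x1 xn1; apply: qpoch_neq0 => //; exact: exprM_neq1.
have N1 : -1 != 1 :> R[i] by rewrite eq_sym -addr_eq0 (pnatr_eq0 _ 2).
exists (fun z => z * E (nu / z)), (fun z => E (-1 * z) * E (- q / z)); split.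
- split=> [z z0|].
    apply: (@derivableM R[i] R[i]^o id); first exact: derivable_id.
    exact: derivable_compc (derivable_divc _ _ z0) (qpoch_derivable _ _ q1 _).
  have t0 : 2 != 0 :> R[i] by rewrite (pnatr_eq0 _ 2).
  (* At [2 * nu] the argument of [E] is [1 / 2]. *)
  exists (2 * nu); rewrite ?mulf_neq0// En0//.
    by rewrite invfM mulrCA divff// mulr1 normfV ger0_norm// invf_le1// ler1n.
  rewrite invfM mulrCA divff// mulr1 invr_eq1.
  by rewrite -subr_eq0 -[2]/(1 + 1) addrK oner_eq0.
- split=> [z z0|].
    apply: (@derivableM R[i] R[i]^o).
      exact: derivable_compc (derivable_mulc _ _) (qpoch_derivable _ _ q1 _).
    exact: derivable_compc (derivable_divc _ _ z0) (qpoch_derivable _ _ q1 _).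
  exists 1; rewrite ?oner_eq0// divr1 mulr1 mulf_neq0 ?En0 ?normrN ?normr1 ?(ltW q1)//.
  by apply: contraTneq q1 => qE; rewrite -normrN qE normr1 ltxx.
move=> z z0; rewrite /E.
(* The functional equation produces [1 - nu / (q * z)] and [1 + z] on the left and [1 + 1 / z] on
   the right; the prefactors [q * z] and [z] balance them. *)
rewrite [in LHS](qpochE _ _ q1 (nu / (q * z))) [in LHS](qpochE _ _ q1 (-1 * z)).
rewrite [X in _ = _ * (_ * (_ * X))](qpochE _ _ q1 (- q / (q * z))).
have -> : q * (nu / (q * z)) = nu / z by field; rewrite z0.
have -> : q * (- q / (q * z)) = - q / z by field; rewrite z0.
have -> : -1 * (q * z) = q * (-1 * z) by ring.
by move: (qpoch _ _ _) (qpoch _ _ _) (qpoch _ _ _) => X Y Z; field; rewrite z0.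
Qed.

Lemma gauge_factor q nu : q != 0 -> `|q| != 1 -> nu != 0 ->
  exists a b : R[i] -> R[i],
    [/\ nonzero_holomorphic a, nonzero_holomorphic b &
     forall z, z != 0 -> a (q * z) * b z = (q * z - nu) * (a z * b (q * z))].
Proof.
move=> q0 qn1 nu0; have [q1|q1|/eqP] := real_ltgtP (normr_real q) (real1 _); last 1 first.
- by rewrite (negPf qn1).
- exact: gauge_factor_lt1.
have [||a [b [ha hb ab]]] := gauge_factor_lt1 q^-1 nu _ _ nu0.
- by rewrite invr_neq0.
- by rewrite normfV invf_lt1// (lt_trans _ q1).
(* For [v = a / b] this pair represents [1 / v (q * z)]; its relation is that of [v] for [q^-1],
   taken at [q * (q * z)]. *)
exists (fun z => b (q * z)), (fun z => a (q * z)).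
split=> [||z z0]; [exact: nonzero_holomorphic_scale..|].
have := ab (q * (q * z)); rewrite mulKf// [b _ * _]mulrC => ->; last by rewrite !mulf_neq0.
by rewrite [a _ * _]mulrC.
Qed.

End GaugeFactor.

(** In [q * (z - nu4) * L1 y] the coefficient of [z * y z] is [- q * nu1 * nu2 * nu3 * nu5 / kappa2
    - nu1 * nu4 - kappa1 / (nu8 * g)], which is [- q] times the displayed [d]; hence the factor
    [- q] in [hd]. *)
Theorem mainTheorem13 (R : realType)
  (q kappa1 kappa2 nu1 nu2 nu3 nu4 nu5 nu6 nu7 nu8 f g d : R[i])
  (hq : q != 0) (hkappa1 : kappa1 != 0) (hkappa2 : kappa2 != 0)
  (hrel : kappa1 ^+ 2 * kappa2 ^+ 2
          = q * (nu1 * nu2 * nu3 * nu4 * nu5 * nu6 * nu7 * nu8))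
  (hg : g != 0) (hf : f = nu4)
  (hd : d = - q * (nu1 * (q * nu2 * nu3 * nu5 + kappa2 * nu4) / (q * kappa2)
                   + kappa1 / (q * nu8) * g^-1)) :
  (forall (y : R[i] -> R[i]) (z : R[i]), z != f -> z != q * f ->
     L1 q kappa1 kappa2 nu1 nu2 nu3 nu4 nu5 nu8 f g y z = 0 <->
     kappa1 * z / nu8 * y (q * z)
     + (nu1 * z ^+ 2 + d * z + q * nu1 * nu2 * nu3 * nu4 * nu5 / kappa2) * y z
     + q * nu1 * nu2 * nu3 * (z - nu4) * y (z / q) = 0)
  /\
  (`|q| != 1 ->
   exists a b : R[i] -> R[i],
     [/\ nonzero_holomorphic a, nonzero_holomorphic b &
      let u := fun x => a x / b x in
      let regular := fun x => (a x != 0) && (b x != 0) in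
      forall (y : R[i] -> R[i]) (z : R[i]), z != 0 ->
        regular (q * z) -> regular z -> regular (z / q) ->
        kappa1 * z / nu8 * (u (q * z) * y (q * z))
        + (nu1 * z ^+ 2 + d * z + q * nu1 * nu2 * nu3 * nu4 * nu5 / kappa2)
            * (u z * y z)
        + q * nu1 * nu2 * nu3 * (z - nu4) * (u (z / q) * y (z / q)) = 0 <->
        kappa1 / nu8 * z * (q * z - nu4) * y (q * z)
        + (nu1 * z ^+ 2 + d * z + q * nu1 * nu2 * nu3 * nu4 * nu5 / kappa2) * y z
        + q * nu1 * nu2 * nu3 * y (z / q) = 0]).
Proof.
(* Through [hrel] this makes [nu4] and [nu8] nonzero. *)
have : kappa1 ^+ 2 * kappa2 ^+ 2 != 0 by rewrite mulf_neq0// expf_neq0.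
rewrite hrel !mulf_eq0 !negb_or -!andbA => /and5P[_ _ _ _ /and5P[n4 _ _ _ n8]].
have scale_eq0 (s A B : R[i]) : s != 0 -> B = s * A -> A = 0 <-> B = 0.
  by move=> s0 ->; split=> [->|/eqP]; rewrite ?mulr0// mulf_eq0 (negPf s0) => /eqP.
split=> [y z|q1].
  rewrite hf => z1 z2; apply: (scale_eq0 (q * (z - nu4))).
    by rewrite mulf_neq0 ?subr_eq0.
  rewrite /L1 /qshift /qshiftV hd.
  move: (y z) (y (z / q)) (y (q * z)) => Y Y1 Y2.
  have h1 : nu4 - z != 0 by rewrite subr_eq0 eq_sym.
  have h2 : nu4 * q - z != 0 by rewrite subr_eq0 eq_sym mulrC.
  by field; rewrite hg h1 hq n8 h2 n4.
have [a [b [ha hb hab]]] := gauge_factor _ _ _ hq q1 n4.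
exists a, b; split=> //= y z z0 /andP[a2 b2] /andP[a0 b0] /andP[a1 b1].
have uq (x : R[i]) : x != 0 -> b x != 0 -> b (q * x) != 0 ->
    a (q * x) / b (q * x) = (q * x - nu4) * (a x / b x).
  move=> x0 bx bqx; apply: (mulIf (mulf_neq0 bqx bx)).
  by rewrite mulrA mulfVK// hab//; field.
(* The whole equation is divisible by [u z], since [u (q * z) = (q * z - nu4) * u z] and, by the
   same relation at [z / q], [(z - nu4) * u (z / q) = u z]. *)
apply: iff_sym; apply: (scale_eq0 (a z / b z)); first by rewrite mulf_neq0// invr_neq0.
have E1 := uq z z0 b0 b2.
have E0 := uq (z / q); rewrite mulrCA divff// mulr1 in E0.
rewrite E1 E0 ?mulf_neq0 ?invr_neq0//.
by move: (a (z / q) / _) => u; ring.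
Qed.
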